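(* There exists a linear, demand-private coded caching scheme for $K=2$ users and $N=2$ files with subpacketization $3$, cache size $M=1$ and rate $R=2/3$ (i.e. each file is split into $3$ subfiles, each cache stores $3$ linear combinations of subfiles, and each multicast transmission consists of $2$ linear combinations of subfiles).
   Context: Linear scheme with $2$ users, $2$ files $A,B$ and subpacketization $f$: each file is split into $f$ equal-size subfiles $A_0,\dots,A_{f-1}$, $B_0,\dots,B_{f-1}$, regarded as independent uniform symbols (or vectors of symbols) over a finite field $\mathbb F$; put $S=(A_0,\dots,A_{f-1},B_0,\dots,B_{f-1})^T$. Placement phase: the server gives User $i\in\{0,1\}$ the cache $Z_i=\mathsf C_iS$, where $\mathsf C_i$ is an $fM\times 2f$ matrix over $\mathbb F$ ($M$ is the cache size in files). The pair $(\mathsf C_0,\mathsf C_1)$ may be chosen at random according to a publicly known distribution; the realized $\mathsf C_i$ (the header $\Theta(Z_i)$) is known only to the server and User $i$. Delivery phase: the demands $D_0,D_1$ are i.i.d. uniform on $\{A,B\}$, independent of the files and of $(\mathsf C_0,\mathsf C_1)$, and are sent privately to the server. Depending on $(\mathsf C_0,\mathsf C_1,D_0,D_1)$ (possibly with additional randomness), the server chooses an $fR\times 2f$ matrix $T$ over $\mathbb F$ and multicasts $X=TS$ together with the header $\Theta(X)=T$ ($R$ is the rate). Decodability: for every realization, User $i$ can recover all subfiles of file $D_i$ as linear combinations of the entries of $Z_i$ and $X$. Demand privacy: $I(D_i,Z_i,\Theta(Z_i),X,\Theta(X);D_j)=0$ for $i\neq j$. *)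

(* Defs.v *)
From HB Require Import structures.
From mathcomp Require Import all_boot all_order all_algebra.
From mathcomp Require Import reals exp.

Set Implicit Arguments.
Unset Strict Implicit.
Unset Printing Implicit Defensive.

Import Order.TTheory GRing.Theory Num.Theory.
Local Open Scope ring_scope.

Definition is_dist (R : realType) (T : finType) (p : T -> R) : Prop :=
  (forall x, 0 <= p x) /\ \sum_x p x = 1.

(* Law of the random variable X under the distribution P. *)
Definition law (R : realType) (Omega T : finType) (P : Omega -> R)
    (X : Omega -> T) (x : T) : R :=
  \sum_(w | X w == x) P w.

(* I(X; Y) in bits.  The convention 0 log 0 = 0 holds since [ln] is total. *)
Definition mutual_info (R : realType) (Omega T U : finType) (P : Omega -> R)
    (X : Omega -> T) (Y : Omega -> U) : R :=
  \sum_(x : T) \sum_(y : U)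
    let pxy := law P (fun w => (X w, Y w)) (x, y) in
    pxy * (ln (pxy / (law P X x * law P Y y)) / ln 2).

(* Users and files are both indexed by 'I_2; file 0 is A and file 1 is B. *)
Definition caches (F : finFieldType) (f m : nat) : finType :=
  {ffun 'I_2 -> 'M[F]_(m, f + f)}.
Definition demands : finType := {ffun 'I_2 -> 'I_2}.

(* The rows of s are the subfiles A_0, ..., A_(f-1), B_0, ..., B_(f-1), each a
   vector of l symbols of F. *)
Definition file (F : finFieldType) (f l : nat) (s : 'M[F]_(f + f, l))
    (k : 'I_2) : 'M[F]_(f, l) :=
  if k == ord0 then usubmx s else dsubmx s.

(* A linear scheme with m rows per cache matrix and r rows per transmission
   matrix.  [delivery c d] is the conditional distribution of the transmission
   matrix T given the cache matrices c and the demands d; T does not depend on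
   the file contents. *)
Record scheme (R : realType) (F : finFieldType) (f m r : nat) := Scheme {
  placement : caches F f m -> R;
  delivery : caches F f m -> demands -> 'M[F]_(r, f + f) -> R;
  placement_dist : is_dist placement;
  delivery_dist : forall c d, is_dist (delivery c d)
}.

Section Scheme.
Variables (R : realType) (F : finFieldType) (f m r : nat).
Variables (sch : scheme R F f m r) (l : nat).

(* Outcomes (C, D, s, T). *)
Definition outcome : finType :=
  (caches F f m * demands * 'M[F]_(f + f, l) * 'M[F]_(r, f + f))%type.

(* C follows the placement distribution, D and s are uniform, C, D and s are
   independent, and T is drawn given (C, D) only. *)
Definition joint (w : outcome) : R :=
  let: (c, d, _, t) := w in
  placement sch c * #|{: demands}|%:R^-1 * #|{: 'M[F]_(f + f, l)}|%:R^-1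
  * delivery sch c d t.

Definition demand (i : 'I_2) (w : outcome) : 'I_2 :=
  let: (_, d, _, _) := w in d i.

(* (D_i, Z_i, header of Z_i, X, header of X). *)
Definition view (i : 'I_2) (w : outcome) :
    'I_2 * 'M[F]_(m, l) * 'M[F]_(m, f + f) * 'M[F]_(r, l) * 'M[F]_(r, f + f) :=
  let: (c, d, s, t) := w in (d i, c i *m s, c i, t *m s, t).

(* The coefficients are chosen before the file contents s; whether they exist
   depends only on (D_i, C_i, T), which user i knows. *)
Definition decodable : Prop :=
  forall (c : caches F f m) (d : demands) (t : 'M[F]_(r, f + f)),
    0 < placement sch c -> 0 < delivery sch c d t ->
    forall i : 'I_2, exists (G : 'M[F]_(f, m)) (H : 'M[F]_(f, r)),
      forall s : 'M[F]_(f + f, l),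
        file s (d i) = G *m (c i *m s) + H *m (t *m s).

Definition demand_private : Prop :=
  forall i j : 'I_2, i != j -> mutual_info joint (view i) (demand j) = 0.

End Scheme.

(* [M] and [rho] are the cache size and the rate in units of files.  The same
   coding matrices must work for subfiles of every length l. *)
Definition linear_private_achievable (R : realType) (f : nat) (M rho : rat) :
    Prop :=
  exists m r : nat,
    [/\ m%:R = f%:R * M :> rat, r%:R = f%:R * rho :> rat &
      exists (F : finFieldType) (sch : scheme R F f m r),
        forall l : nat, (0 < l)%N ->
          decodable sch l /\ demand_private sch l].

(* Main.v *)
Require Import Defs.
From mathcomp Require Import all_boot all_order all_algebra.
From mathcomp Require Import reals exp.

(** Let [o, y_0, y_1] be a basis of [F_2^3].  Each user [u] gets a uniform
    secret key [k_u], and [e_u] is the sum of the key and the demand of [u];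
    write [point e = o + e_0 y_0 + e_1 y_1].  A row vector applied to the
    subfiles of A or B gives one symbol.  The cache of [u] holds
    [y_(1-u) A], [y_(1-u) B] and [v A + v B] with [v = o + k_u y_u], and the
    server sends [point (e + 1) A] and [point e B].  The line through [v] in
    direction [y_(1-u)] contains exactly one of the two transmitted points,
    namely the one applied to the file that [u] does not want: it cancels the
    interference in [v A + v B], and the other point completes [y_(1-u), v] to
    a basis.  Privacy holds because, given the demand and the key of one user,
    the other coordinate of [e] is uniform whatever the other demand is. *)

Set Implicit Arguments.
Unset Strict Implicit.
Unset Printing Implicit Defensive.

Import Order.TTheory GRing.Theory Num.Theory.
Local Open Scope ring_scope.

(** * Zero mutual information from symmetries of the joint law *)

Section Privacy.
Variable R : realType.

Lemma sum_law_pair (Omega T U : finType) (P : Omega -> R)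
    (X : Omega -> T) (Y : Omega -> U) (x : T) :
  \sum_y law P (fun w => (X w, Y w)) (x, y) = law P X x.
Proof. by rewrite [RHS](partition_big Y xpredT). Qed.

Lemma sum_law_pair_fst (Omega T U : finType) (P : Omega -> R)
    (X : Omega -> T) (Y : Omega -> U) (y : U) :
  \sum_x law P (fun w => (X w, Y w)) (x, y) = law P Y y.
Proof.
rewrite [RHS](partition_big X xpredT) //=.
by apply: eq_bigr => x _; apply: eq_bigl => w; rewrite xpair_eqE andbC.
Qed.

Lemma sum_law (Omega U : finType) (P : Omega -> R) (Y : Omega -> U) :
  \sum_y law P Y y = \sum_w P w.
Proof. by rewrite [RHS](partition_big Y xpredT). Qed.

Lemma mutual_info_indep (Omega T U : finType) (P : Omega -> R)
    (X : Omega -> T) (Y : Omega -> U) :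
  (forall x y, law P (fun w => (X w, Y w)) (x, y) = law P X x * law P Y y) ->
  mutual_info P X Y = 0.
Proof.
move=> indep; rewrite /mutual_info big1 // => x _; rewrite big1 // => y _ /=.
(* Where the product vanishes, the factor [pxy] kills the term; elsewhere the quotient is 1 and its
   logarithm 0. *)
rewrite indep; have [->|nz] := eqVneq (law P X x * law P Y y) 0.
  by rewrite mul0r.
by rewrite divff // ln1 mul0r mulr0.
Qed.

(** A joint law constant in [y] forces [Y] to be uniform, by total mass 1, and each joint value to
    be [law P X x] divided by [#|U|]. *)
Lemma indep_of_law_const (Omega T U : finType) (P : Omega -> R)
    (X : Omega -> T) (Y : Omega -> U) :
  \sum_w P w = 1 ->
  (forall x y y', law P (fun w => (X w, Y w)) (x, y) =
                  law P (fun w => (X w, Y w)) (x, y')) ->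
  forall x y, law P (fun w => (X w, Y w)) (x, y) = law P X x * law P Y y.
Proof.
move=> P1 cst x y.
have -> : law P X x = law P (fun w => (X w, Y w)) (x, y) *+ #|U|.
  by rewrite -(sum_law_pair P X Y) -sumr_const; apply: eq_bigr => y' _; apply: cst.
rewrite mulrnAl -mulrnAr; suff -> : law P Y y *+ #|U| = 1 by rewrite mulr1.
rewrite -P1 -(sum_law P Y) -sumr_const; apply: eq_bigr => y' _.
by rewrite -!(sum_law_pair_fst P X Y); apply: eq_bigr => x' _; apply: cst.
Qed.

(** Reindexing along [f], a bijection because [Omega] is finite: a measure-preserving symmetry of
    the outcomes becomes a symmetry of the law. *)
Lemma law_bij (Omega T : finType) (P : Omega -> R) (X : Omega -> T)
    (f : Omega -> Omega) (g : T -> T) x :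
  injective f -> injective g -> (forall w, P (f w) = P w) ->
  (forall w, X (f w) = g (X w)) -> law P X (g x) = law P X x.
Proof.
move=> finj ginj Pf Xf; rewrite /law (reindex_inj finj).
by apply: eq_big => w; rewrite ?Pf // Xf (inj_eq ginj).
Qed.

Lemma sum_uniform (T : finType) :
  (0 < #|T|)%N -> \sum_(x : T) (#|T|%:R^-1 : R) = 1.
Proof. by move=> T0; rewrite sumr_const -[LHS]mulr_natr mulVf // pnatr_eq0 -lt0n. Qed.

Lemma sum_joint (F : finFieldType) (f m r l : nat) (sch : scheme R F f m r) :
  \sum_w joint sch (l := l) w = 1.
Proof.
have [_ pl1] := placement_dist sch.
have inner c d : \sum_(s : 'M[F]_(f + f, l)) \sum_t
    joint sch (c, d, s, t) = placement sch c * #|{: demands}|%:R^-1.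
  have files1 : \sum_(s : 'M[F]_(f + f, l)) #|{: 'M[F]_(f + f, l)}|%:R^-1 = 1 :> R.
    by apply: sum_uniform; apply/card_gt0P; exists 0.
  rewrite -[RHS]mulr1 -[X in _ = _ * X]files1 mulr_sumr; apply: eq_bigr => s _ /=.
  by rewrite -mulr_sumr (delivery_dist sch c d).2 mulr1.
transitivity (\sum_c \sum_d \sum_(s : 'M[F]_(f + f, l)) \sum_t
    joint sch (c, d, s, t)).
  by rewrite !pair_bigA /=; apply: eq_bigr => -[[[c d] s] t].
rewrite -[RHS]pl1; apply: eq_bigr => c _.
under eq_bigr do rewrite inner.
rewrite -mulr_sumr sum_uniform ?mulr1 //; apply/card_gt0P.
by exists [ffun=> ord0].
Qed.

End Privacy.

(** * Linear algebra of decoding over any field *)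

Section Decoding.
Variables (F : fieldType) (n : nat).
Implicit Types a v p q : 'rV[F]_n.

Definition cache_rows a v : 'M[F]_(1 + 1 + 1, n + n) :=
  col_mx (block_mx a 0 0 a) (row_mx v v).

Definition delivery_rows p q : 'M[F]_(1 + 1, n + n) := block_mx p 0 0 q.

Lemma addsmx3P a v p :
  (1%:M <= a + v + p)%MS ->
  exists n1 n2 n3 : 'cV[F]_n, 1%:M = n1 *m a + n2 *m v + n3 *m p.
Proof.
case/sub_addsmxP=> -[x n3] /=; have /sub_addsmxP[[n1 n2] ->] /= := submxMl x (a + v)%MS.
by exists n1, n2, n3.
Qed.

(* The mixed row [v A + v B], stripped of its interference
   [v B = (v + e a) B - e a B], gives [v A]. *)
Lemma decode_fst a v p e :
  (1%:M <= a + v + p)%MS ->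
  exists (G : 'M[F]_(n, 1 + 1 + 1)) (H : 'M[F]_(n, 1 + 1)),
    G *m cache_rows a v + H *m delivery_rows p (v + e *: a) = row_mx 1%:M 0.
Proof.
case/addsmx3P=> n1 [n2 [n3 ->]].
exists (row_mx (row_mx n1 (e *: n2)) n2), (row_mx n3 (- n2)).
rewrite /cache_rows /delivery_rows /block_mx !mul_row_col !mul_mx_row.
rewrite !mulmx0 !add_row_mx !add0r !addr0; congr row_mx.
by rewrite mulmxDr !mulNmx -scalemxAl -scalemxAr addrA addrK subrr.
Qed.

(** Mirror image: the interference is now [v A], and removing it leaves [v B]. *)
Lemma decode_snd a v p e :
  (1%:M <= a + v + p)%MS ->
  exists (G : 'M[F]_(n, 1 + 1 + 1)) (H : 'M[F]_(n, 1 + 1)),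
    G *m cache_rows a v + H *m delivery_rows (v + e *: a) p = row_mx 0 1%:M.
Proof.
case/addsmx3P=> n1 [n2 [n3 ->]].
exists (row_mx (row_mx (e *: n2) n1) n2), (row_mx (- n2) n3).
rewrite /cache_rows /delivery_rows /block_mx !mul_row_col !mul_mx_row.
rewrite !mulmx0 !add_row_mx !add0r !addr0; congr row_mx.
by rewrite mulmxDr !mulNmx -scalemxAl -scalemxAr addrA addrK subrr.
Qed.

End Decoding.

(** * The keyed scheme over ['F_2] *)

Section Scheme.
Variable R : realType.
Local Notation F := 'F_2.
Local Notation keys := {ffun 'I_2 -> F}.
Local Notation cachepair := {ffun 'I_2 -> 'M[F]_(1 + 1 + 1, 3 + 3)}.

Definition origin : 'rV[F]_3 := delta_mx 0 ord0.
(** Users are read as elements of ['F_2], so that [u + 1] is the other user. *)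
Definition axis (u : F) : 'rV[F]_3 := delta_mx 0 (lift ord0 (u : 'I_2)).
Definition point (e : keys) : 'rV[F]_3 := origin + \sum_u e u *: axis u.

Definition cache_pair (k : keys) : cachepair :=
  [ffun u => cache_rows (axis (u + 1 : F)) (origin + k u *: axis u)].

(** The coefficient of [axis u] in the A half of the mixed row; it recovers the key, so that the
    delivery can be a function of the caches alone. *)
Definition key_of (c : cachepair) : keys :=
  [ffun u : 'I_2 => c u (rshift (1 + 1) (ord0 : 'I_1)) (lshift 3 (lift ord0 u))].

Definition transmission (e : keys) : 'M[F]_(2, 3 + 3) :=
  delivery_rows (point (e + [ffun=> 1])) (point e).

Lemma pointE e (u : F) :
  point e = origin + e u *: axis u + e (u + 1) *: axis (u + 1).
Proof.
rewrite /point -addrA; congr (_ + _); rewrite !big_ord_recl big_ord0 addr0.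
case: u => -[|[|//]] i; first by congr (e _ *: axis _ + e _ *: axis _); apply: val_inj.
by rewrite addrC; congr (e _ *: axis _ + e _ *: axis _); apply: val_inj.
Qed.

(** The last two points differ by 1 along [axis u], so modulo [axis (u + 1)] their difference is
    [axis u]; subtracting [k *: axis u] then gives [origin]. *)
Lemma axes_span (u k c : F) :
  (1%:M <= axis (u + 1)%R + (origin + k *: axis u)%R +
           (origin + (k + 1) *: axis u + c *: axis (u + 1))%R)%MS.
Proof.
set a := axis (u + 1); set v := (origin + _)%R; set p := (_ + c *: a)%R.
have sa : (a <= a + v + p)%MS by rewrite -addsmxA addsmxSl.
have sv : (v <= a + v + p)%MS by rewrite (submx_trans (addsmxSr a v)) ?addsmxSl.
have sp : (p <= a + v + p)%MS by rewrite addsmxSr.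
have subS (x y : 'rV[F]_3) : (x <= a + v + p -> y <= a + v + p -> (x - y)%R <= a + v + p)%MS.
  by move=> xS yS; apply: addmx_sub; rewrite ?eqmx_opp.
have su : (axis u <= a + v + p)%MS.
  have -> : axis u = (p - v - c *: a)%R.
    by rewrite /p scalerDl scale1r addrA -/v addrAC [(v + _)%R]addrC !addrK.
  exact: subS _ _ (subS _ _ sp sv) (scalemx_sub c sa).
have so : (origin <= a + v + p)%MS.
  rewrite -[origin](addrK (k *: axis u)) -/v.
  exact: subS _ _ sv (scalemx_sub k su).
apply/row_subP=> i; rewrite row1.
case: (unliftP ord0 i) => [j ->|-> //].
suff [<-//|<-//] : axis u = delta_mx 0 (lift ord0 j) \/ a = delta_mx 0 (lift ord0 j).
rewrite /a /axis; case: j => -[|[|//]] j0; case: u @a @v @p sa sv subS sp su so => -[|[|//]] i0 *.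
- by left; congr delta_mx; apply: val_inj.
- by right; congr delta_mx; apply: val_inj.
- by right; congr delta_mx; apply: val_inj.
- by left; congr delta_mx; apply: val_inj.
Qed.

(** The linear part of the affine map [cache_pair]. It turns a change of keys into a translation of
    all cache pairs, including those of probability 0. *)
Definition cache_shift (k : keys) : cachepair :=
  [ffun u => col_mx (0 : 'M[F]_(1 + 1, 3 + 3)) (row_mx (k u *: axis u) (k u *: axis u))].

Lemma cache_pairD k k' : cache_pair (k + k') = cache_pair k + cache_shift k'.
Proof.
apply/ffunP=> u; rewrite !ffunE /cache_rows add_col_mx addr0 add_row_mx.
by rewrite scalerDl addrA.
Qed.

Lemma key_of_shift c k : key_of (c + cache_shift k) = key_of c + k.
Proof.
apply/ffunP=> u; rewrite !ffunE [LHS]mxE; congr (_ + _).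
by rewrite col_mxEd row_mxEl !mxE !eqxx mulr1.
Qed.

Lemma cache_pairK : cancel cache_pair key_of.
Proof.
move=> k; apply/ffunP=> u.
by rewrite !ffunE col_mxEd row_mxEl !mxE !eqxx mulr1 add0r.
Qed.

Definition key_placement (c : caches F 3 3) : R :=
  law (fun _ : keys => #|{: keys}|%:R^-1) cache_pair c.

Definition key_delivery (c : caches F 3 3) (d : demands) (t : 'M[F]_(2, 3 + 3)) : R :=
  (t == transmission ((d : keys) + key_of c))%:R.

Lemma key_placement_dist : is_dist key_placement.
Proof.
split=> [c|]; first by apply: sumr_ge0 => k _; rewrite invr_ge0 ler0n.
by rewrite sum_law sum_uniform //; apply/card_gt0P; exists 0.
Qed.

Lemma key_delivery_dist c d : is_dist (key_delivery c d).
Proof.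
split=> [t|]; first exact: ler0n.
rewrite (bigD1 (transmission ((d : keys) + key_of c))) //= /key_delivery eqxx.
by rewrite big1 ?addr0 // => t /negbTE->.
Qed.

Definition key_scheme : scheme R F 3 3 2 :=
  Scheme key_placement_dist key_delivery_dist.

Lemma key_placement_gt0 c : 0 < key_placement c -> exists k, c = cache_pair k.
Proof.
move=> c0; have [/existsP[k /eqP <-]|/existsPn nk] := boolP [exists k, cache_pair k == c].
  by exists k.
by move: c0; rewrite /key_placement /law big_pred0 ?ltxx // => k; apply/negbTE.
Qed.

Lemma key_placement_shift (c : cachepair) k :
  key_placement (c + cache_shift k) = key_placement c.
Proof.
pose g (c' : caches F 3 3) : caches F 3 3 := (c' : cachepair) + cache_shift k.
apply: (law_bij (X := cache_pair : keys -> caches F 3 3) (f := +%R^~ k) (g := g) c) => //.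
- exact: addIr.
- by move=> c1 c2 /addIr.
- by move=> k'; rewrite cache_pairD.
Qed.

(** Only the sum of demand and key matters, and [k + k] vanishes in characteristic 2. *)
Lemma key_delivery_shift (c : cachepair) (d k : keys) t :
  key_delivery (c + cache_shift k) (d + k) t = key_delivery c d t.
Proof.
rewrite /key_delivery key_of_shift addrACA -[k + k]mulr2n.
suff -> : k *+ 2 = 0 by rewrite addr0.
by apply/ffunP=> u; rewrite !ffunE; case: (k u) => -[|[|//]] i; apply: val_inj.
Qed.

Lemma decode_key (k d : keys) (u : 'I_2) :
  exists (G : 'M[F]_(3, 3)) (H : 'M[F]_(3, 2)),
    G *m cache_pair k u + H *m transmission (d + k) =
      if d u == 0 then row_mx 1%:M 0 else row_mx 0 1%:M.
Proof.
rewrite ffunE /transmission !(pointE _ u) !ffunE.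
(* If [d u = 0], the point applied to B has [u]-coordinate [k u] and lies on the line of user [u];
   if [d u = 1], the point applied to A does, since [1 + k u + 1 = k u]. *)
have [-> | du] := eqVneq (d u) 0.
  by rewrite add0r; apply/decode_fst/axes_span.
have -> : d u = 1 by case: (d u) du => -[|[|//]] i // _; apply: val_inj.
have -> : 1 + k u + 1 = k u by case: (k u) => -[|[|//]] i; apply: val_inj.
by rewrite [1 + _]addrC; apply/decode_snd/axes_span.
Qed.

Lemma key_scheme_decodable l : decodable key_scheme l.
Proof.
move=> c d t /key_placement_gt0[k ->] /=.
rewrite /key_delivery cache_pairK; case: eqP => [-> _ i|_]; last by rewrite ltxx.
have [G [H GH]] := decode_key k d i; exists G, H => s.
rewrite !mulmxA -mulmxDl GH /file -[s in RHS]vsubmxK.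
by case: eqP => _; rewrite mul_row_col mul0mx mul1mx ?addr0 ?add0r.
Qed.

(* Changing the demand and the key of user [j] together changes neither what
   the other user sees nor the probability of the outcome. *)
Lemma key_scheme_private l : demand_private key_scheme l.
Proof.
move=> i j ij; apply/mutual_info_indep/indep_of_law_const; first exact: sum_joint.
pose e : keys := [ffun u => (u == j)%:R].
pose f (w : outcome F 3 3 2 l) : outcome F 3 3 2 l := let: (c, d, s, t) := w in
  ((c : cachepair) + cache_shift e, (d : keys) + e, s, t).
move=> x y y'.
(* Adding 1 exchanges the two demands, so invariance under this flip is constancy in [y]. *)
have flip z : law (joint key_scheme (l := l)) (fun w => (view i w, demand j w))
    (x, (z : F) + 1) =
  law (joint key_scheme (l := l)) (fun w => (view i w, demand j w)) (x, z).
  apply: (law_bij (f := f) (g := fun p => (p.1, (p.2 : F) + 1)) (x, z)).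
  - move=> [[[c d] s] t] [[[c' d'] s'] t'] /eqP; rewrite !xpair_eqE.
    by move=> /andP[/andP[/andP[/eqP/addIr-> /eqP/addIr->] /eqP->] /eqP->].
  - move=> [x1 z1] [x2 z2] /eqP; rewrite xpair_eqE.
    by move=> /andP[/eqP/= -> /eqP/addIr->].
  - move=> [[[c d] s] t] /=.
    by rewrite key_placement_shift key_delivery_shift.
  - move=> [[[c d] s] t] /=; rewrite !ffunE eqxx (negbTE ij) addr0.
    by rewrite !scale0r row_mx0 col_mx0 addr0.
have [->//|yy'] := eqVneq y' y.
have -> : y' = (y : F) + 1; last by rewrite flip.
by case: y y' yy' => -[|[|//]] ? [[|[|//]] ?] // _; apply: val_inj.
Qed.

End Scheme.

Theorem mainTheorem1 (R : realType) :
  linear_private_achievable R 3 1 (2 / 3).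
Proof.
exists 3, 2; split=> //.
exists 'F_2, (key_scheme R) => l _.
by split; [exact: key_scheme_decodable | exact: key_scheme_private].
Qed.
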